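(* Let $G$ be a finite simple connected graph on $n$ vertices and let $w:E(G)\to\mathbb{R}_{>0}$ be a positive edge-weighting. For each edge $e\in E(G)$ define $C_w(e)$ to be the maximum of $w(C)=\sum_{f\in E(C)}w(f)$ over all cycles $C\subseteq G$ with $e\in E(C)$ if $e$ lies on some cycle, and $C_w(e)=2w(e)$ if $e$ is a bridge. Then $$\sum_{e\in E(G)}\frac{w(e)}{C_w(e)}\le \frac{n-1}{2}.$$
   Context: A bridge is an edge lying on no cycle. For a subgraph $H$, $w(H)=\sum_{e\in E(H)}w(e)$. *)

(* Defs.v *)
(* Graphs: simple graph = symmetric irreflexive rel on a finType. *)
From HB Require Import structures.
From mathcomp Require Import all_boot all_order all_algebra.
From mathcomp Require Import boolp.
Set Implicit Arguments. Unset Strict Implicit. Unset Printing Implicit Defensive.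
Import Order.TTheory GRing.Theory Num.Theory.
Local Open Scope ring_scope.

Section Graph.
Variables (T : finType) (g : rel T).

Definition is_edge (E : {set T}) : bool :=
  [exists x, exists y, g x y && (E == [set x; y])].

Definition is_cycle_edges (F : {set {set T}}) : Prop :=
  exists s : seq T, [/\ (3 <= size s)%N, uniq s, path.cycle g s &
    F = [set [set x; next s x] | x in s]].

Variables (R : realFieldType) (w : {set T} -> R).

Definition wsum (F : {set {set T}}) : R := \sum_(E in F) w E.

Definition Cw (E : {set T}) : R :=
  if `[< exists F, is_cycle_edges F /\ E \in F >] then
    \big[Num.max/0]_(F : {set {set T}} | `[< is_cycle_edges F >] && (E \in F)) wsum F
  else 2 * w E.

End Graph.

(* Main.v *)
Require Import Defs.
From HB Require Import structures.
From mathcomp Require Import all_boot all_order all_algebra.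
From mathcomp Require Import boolp.
From mathcomp Require Import ring lra zify.
Import Order.TTheory GRing.Theory Num.Theory.
Local Open Scope ring_scope.
Set Implicit Arguments. Unset Strict Implicit. Unset Printing Implicit Defensive.

(** Replace [w E] by [w E / Cw E]: every cycle then has weight at most [1] and
    every bridge weight [1/2], so it suffices to show that a weighted graph on
    [V] whose cycles weigh at most [c] and whose bridges weigh at most [c/2] has
    total weight at most [(#|V| - 1) c / 2] (Bondy and Fan).

    Induct on [#|V|]. A bridge splits the graph into two smaller ones, so assume
    there is none. If every cycle is Hamiltonian, the graph is a cycle.
    Otherwise let [s] be a heaviest non-Hamiltonian cycle, of weight [c* <= c],
    and [B] the set of vertices off [s]. The induction hypothesis bounds the
    graph induced on [s] by [(#|s| - 1) c* / 2].
    If [B = {v}], inserting [v] between successive neighbours of it on [s] gives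
    [2 d(v) <= c* + #|s| (c - c* )], which is what is needed.
    If [#|B| >= 2], contract [s] to a vertex [z], giving the edge [vz] the total
    weight [d(v)] of the edges from [v] to [s]. The contracted graph has
    [#|B| + 1] vertices, and all its cycles weigh at most [c]: for a path of
    weight [p] in [B] from [v] to [u], rerouting arcs of [s] through [v], through
    [u] or through the whole path, and summing over the arcs, yields
    [d(v) + p + d(u) <= c]. *)

(** * Sums along a chain *)

Section ChainSums.
Variable R : realFieldType.
Implicit Types (S a b : nat -> R) (P : pred nat).

Lemma sum_split_at (F : nat -> R) P i k j : (i < k < j)%N -> P k ->
  \sum_(i.+1 <= l < j | P l) F l =
  \sum_(i.+1 <= l < k | P l) F l + F k + \sum_(k.+1 <= l < j | P l) F l.
Proof.
move=> /andP[ik kj] Pk.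
by rewrite (@big_cat_nat _ _ _ k) ?(ltnW kj) //= (big_ltn_cond kj) Pk addrA.
Qed.

(** Adding the hypothesis over consecutive points of [P] telescopes the right-hand side and counts
    every interior [a k] twice; the induction splits at any interior point of [P]. The values of [a]
    may be negative, as can happen after the shift in [star_bound]. *)
Lemma chain_sum S a P i j :
  (i < j)%N -> P i -> P j ->
  (forall k l, (i <= k)%N -> (k < l)%N -> (l <= j)%N -> P k -> P l ->
     a k + a l <= S l - S k) ->
  a i + a j + 2 * \sum_(i.+1 <= k < j | P k) a k <= S j - S i.
Proof.
have [m] := ubnP (j - i)%N; elim: m i j => // m IH i j lem ij Pi Pj H.
have [/hasP[k]|/hasPn no] := boolP (has P (index_iota i.+1 j)).
  rewrite mem_index_iota => /andP[ik kj] Pk.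
  have [lt1 lt2] : (k - i < m)%N /\ (j - k < m)%N by clear -lem ik kj; lia.
  have h1 : a i + a k + 2 * \sum_(i.+1 <= l < k | P l) a l <= S k - S i.
    exact: IH lt1 ik _ _ (fun x y ix xy yk => H x y ix xy (leq_trans yk (ltnW kj))).
  have h2 : a k + a j + 2 * \sum_(k.+1 <= l < j | P l) a l <= S j - S k.
    exact: IH lt2 kj _ _ (fun x y ix xy yk => H x y (leq_trans (ltnW ik) ix) xy yk).
  rewrite (sum_split_at _ _ Pk) ?ik //; lra.
rewrite big_seq_cond big1 ?mulr0 ?addr0; first exact: H.
by move=> l /andP[/no /negP].
Qed.

(** Position [n] is position [0] again. The bound is assumed only for proper arcs, so a second point
    [j] of [P] is used to cut the circle into two chains. *)
Lemma circle_sum S a P n j :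
  (0 < j < n)%N -> P 0%N -> P j -> P n -> a n = a 0%N ->
  (forall k l, (k < l)%N -> (l <= n)%N -> (0 < k)%N || (l < n)%N -> P k -> P l ->
     a k + a l <= S l - S k) ->
  2 * \sum_(0 <= k < n | P k) a k <= S n - S 0%N.
Proof.
move=> /andP[j0 jn] P0 Pj Pn an H.
have h1 : a 0%N + a j + 2 * \sum_(1 <= k < j | P k) a k <= S j - S 0%N.
  apply: chain_sum => // k l _ kl lj; apply: H => //; first exact: leq_trans (ltnW jn).
  by rewrite (leq_ltn_trans lj jn) orbT.
have h2 : a j + a n + 2 * \sum_(j.+1 <= k < n | P k) a k <= S n - S j.
  by apply: chain_sum => // k l jk kl ln; apply: H; rewrite // (leq_trans j0 jk).
rewrite big_ltn_cond ?P0 ?(ltn_trans j0 jn) // (@sum_split_at _ _ 0 j n) ?j0 //.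
rewrite an in h2; lra.
Qed.

(** Each maximum is attained at a positive value, so one of the four bounds applies; in the mixed
    cases the extra [q] is dropped. This gives the pointwise maximum the hypothesis of
    [chain_sum]. *)
Lemma max_pair_le (a b a' b' q d : R) :
  0 <= q -> 0 <= a -> 0 <= b -> 0 <= a' -> 0 <= b' ->
  [/\ 0 < a -> 0 < a' -> a + a' <= d, 0 < b -> 0 < b' -> b + b' <= d,
      0 < a -> 0 < b' -> a + b' + q <= d & 0 < b -> 0 < a' -> b + a' + q <= d] ->
  (0 < a) || (0 < b) -> (0 < a') || (0 < b') ->
  Num.max a b + Num.max a' b' <= d.
Proof.
move=> q0 a0 b0 a0' b0' [h1 h2 h3 h4] P1 P2.
have pos x y : 0 <= x -> 0 <= y -> (0 < x) || (0 < y) -> x <= y -> 0 < y.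
  by move=> x0 y0 /orP[x1 xy|//]; apply: lt_le_trans x1 xy.
case: (leP a b) => c1; case: (leP a' b') => c2.
- by apply: h2; [apply: pos c1 | apply: pos c2].
- by apply: le_trans (h4 _ _); [rewrite lerDl | apply: pos c1 | apply: pos (ltW c2); rewrite // orbC].
- by apply: le_trans (h3 _ _); [rewrite lerDl | apply: pos (ltW c1); rewrite // orbC | apply: pos c2].
- by apply: h1; [apply: pos (ltW c1) | apply: pos (ltW c2)]; rewrite // orbC.
Qed.

(** Intended reading: [S] is the weight of a cycle up to a position, [a k] and [b k] are the weights
    of the edges from the two ends of an outside path to the vertex at position [k], and [q] is the
    path weight less a correction. A detour exists only along actual edges, hence the positivity
    premises. *)
Definition arcs_bounded S a b (q : R) i j := forall k l,
  (i <= k)%N -> (k < l)%N -> (l <= j)%N ->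
  [/\ 0 < a k -> 0 < a l -> a k + a l <= S l - S k,
      0 < b k -> 0 < b l -> b k + b l <= S l - S k,
      0 < a k -> 0 < b l -> a k + b l + q <= S l - S k &
      0 < b k -> 0 < a l -> b k + a l + q <= S l - S k].

(** This is [chain_sum] for the maximum of [a] and [b]: an interior point then counts twice the
    maximum, which is at least [a k + b k], and points where both vanish contribute nothing. *)
Lemma chain_sum_max S a b (q : R) i j :
  0 <= q -> (forall k, 0 <= a k) -> (forall k, 0 <= b k) ->
  (i < j)%N -> (0 < a i) || (0 < b i) -> (0 < a j) || (0 < b j) ->
  arcs_bounded S a b q i j ->
  Num.max (a i) (b i) + Num.max (a j) (b j) + \sum_(i.+1 <= k < j) (a k + b k)
    <= S j - S i.
Proof.
move=> q0 a0 b0 ij Pi Pj H.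
pose P k := (0 < a k) || (0 < b k).
pose M k := Num.max (a k) (b k).
have aM k : a k <= M k by rewrite /M le_max lexx.
have bM k : b k <= M k by rewrite /M le_max lexx orbT.
apply: (@le_trans _ _ (M i + M j + 2 * \sum_(i.+1 <= x < j | P x) M x)).
  rewrite lerD2l (bigID P) /= [X in _ + X]big1 ?addr0 => [|k].
    rewrite mulr_sumr; apply: ler_sum => k _.
    by have := aM k; have := bM k; lra.
  rewrite /P negb_or -!leNgt => /andP[h1 h2].
  by have := a0 k; have := b0 k; lra.
apply: chain_sum ij Pi Pj _ => k l ik kl lj.
exact: max_pair_le q0 _ _ _ _ (H k l ik kl lj).
Qed.

(* Somewhere between [i] and [j] the chain switches from [a] to [b], which earns
   the additional term [q]. *)
Lemma chain_sum_switch S a b (q : R) i j :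
  0 <= q -> (forall k, 0 <= a k) -> (forall k, 0 <= b k) ->
  (i < j)%N -> 0 < a i -> 0 < b j -> arcs_bounded S a b q i j ->
  a i + b j + q + \sum_(i.+1 <= k < j) (a k + b k) <= S j - S i.
Proof.
move=> q0 a0 b0.
have [m] := ubnP (j - i)%N; elim: m i j => // m IH i j lem ij ai bj H.
pose P k := (0 < a k) || (0 < b k).
have [/hasP[k]|/hasPn no] := boolP (has P (index_iota i.+1 j)).
  rewrite mem_index_iota => /andP[ik kj] Pk.
  have [lt1 lt2] : (k - i < m)%N /\ (j - k < m)%N by clear -lem ik kj; lia.
  rewrite (@sum_split_at _ predT i k j) ?ik //.
  have Hl : arcs_bounded S a b q i k.
    by move=> x y ix xy yk; apply: H ix xy (leq_trans yk (ltnW kj)).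
  have Hr : arcs_bounded S a b q k j.
    by move=> x y kx xy yj; apply: H (leq_trans (ltnW ik) kx) xy yj.
  (* If [b k] is positive, the switch is sought to the left of [k]; otherwise [a k] is positive and
     it is sought to the right. [chain_sum_max] covers the other half. *)
  have [bk|bk] := ltP 0 (b k).
    have h1 := IH i k lt1 ik ai bk Hl.
    have := chain_sum_max q0 a0 b0 kj Pk _ Hr; rewrite bj orbT => /(_ isT) h2.
    have : a k + b j <= Num.max (a k) (b k) + Num.max (a j) (b j).
      by apply: lerD; rewrite le_max lexx ?orbT.
    clear -h1 h2; lra.
  have ak : 0 < a k by move: Pk; rewrite /P (le_gtF bk) orbF.
  have h1 := IH k j lt2 kj ak bj Hr.
  have := chain_sum_max q0 a0 b0 ik _ Pk Hl; rewrite ai => /(_ isT) h2.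
  have : a i + b k <= Num.max (a i) (b i) + Num.max (a k) (b k).
    by apply: lerD; rewrite le_max lexx ?orbT.
  clear -h1 h2; lra.
rewrite big_seq big1 ?addr0.
  by have [_ _ h _] := H i j (leqnn _) ij (leqnn _); apply: h.
move=> l /no; rewrite /P negb_or -!leNgt => /andP[h1 h2].
by apply/eqP; rewrite eq_le addr_ge0 // andbT -[0]addr0 lerD.
Qed.

End ChainSums.

(** * Weighted graphs *)

Section WeightedGraph.
Variables (R : realFieldType) (T : finType).
Implicit Types (w : T -> T -> R) (V A : {set T}) (s p q t : seq T) (c : R).

Definition posrel w : rel T := fun x y => 0 < w x y.

Fixpoint pathw w x p : R :=
  if p is y :: p' then w x y + pathw w y p' else 0.

Definition cyclew w s : R := if s is x :: p then pathw w x (rcons p x) else 0.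

Definition vcycle w V s : bool :=
  [&& (2 < size s)%N, uniq s, path.cycle (posrel w) s & all (mem V) s].

Definition edge_del w V x y : rel T :=
  [rel a b | [&& a \in V, b \in V, 0 < w a b & [set a; b] != [set x; y]]].

Definition is_weight w : Prop :=
  [/\ forall x y, w x y = w y x, forall x, w x x = 0 & forall x y, 0 <= w x y].

(* A graph is encoded by its weight function, the edges being the pairs of
   positive weight; an edge is not a bridge iff its ends stay connected when it
   is deleted. *)
Definition admissible w V c : Prop :=
  [/\ 0 <= c,
      forall s, vcycle w V s -> cyclew w s <= c &
      forall x y, x \in V -> y \in V -> 0 < w x y ->
        connect (edge_del w V x y) x y \/ 2 * w x y <= c].

Lemma pathw_cat w x p q : pathw w x (p ++ q) = pathw w x p + pathw w (last x p) q.
Proof. by elim: p x => [|y p IH] x /=; rewrite ?add0r // IH addrA. Qed.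

Lemma pathw_rcons w x p y : pathw w x (rcons p y) = pathw w x p + w (last x p) y.
Proof. by rewrite -cats1 pathw_cat /= addr0. Qed.

Lemma pathw_rev w x p : (forall a b, w a b = w b a) ->
  pathw w (last x p) (rev (belast x p)) = pathw w x p.
Proof.
move=> wC; elim: p x => [|y p IH] x //=.
rewrite rev_cons pathw_rcons IH addrC wC; congr (w x _ + _).
by case: p {IH} => [|z p] //=; rewrite rev_cons last_rcons.
Qed.

Lemma eq_pathw w w' x p : {in x :: p &, forall a b, w a b = w' a b} ->
  pathw w x p = pathw w' x p.
Proof.
elim: p x => [|y p IH] x //= H; rewrite H ?inE ?eqxx ?orbT // IH // => a b ha hb.
by apply: H; rewrite in_cons (ha, hb) orbT.
Qed.

Lemma pathw_ge0 w x p : is_weight w -> 0 <= pathw w x p.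
Proof. by case=> _ _ w0; elim: p x => //= y p IH x; rewrite addr_ge0. Qed.

Lemma cyclew_ge0 w s : is_weight w -> 0 <= cyclew w s.
Proof. by move=> ww; case: s => //= x p; apply: pathw_ge0. Qed.

Lemma cyclew_rot w n s : cyclew w (rot n s) = cyclew w s.
Proof.
have r1 q : cyclew w (rot 1 q) = cyclew w q.
  case: q => [|x [|y q]] //; rewrite /rot /= cats1 !pathw_rcons /=.
  by rewrite last_rcons addrC.
have [|le_s] := leqP (size s) n; first by move/rot_oversize->.
elim: n le_s => [|n IH] lt_s; first by rewrite rot0.
by rewrite (rotS (ltnW lt_s)) r1 IH // ltnW.
Qed.

Lemma vcycle_rot w V n s : vcycle w V (rot n s) = vcycle w V s.
Proof.
rewrite /vcycle size_rot rot_uniq rot_cycle; do 3 congr (_ && _).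
exact/eq_all_r/mem_rot.
Qed.

Lemma vcycle_subset w V V' s : vcycle w V s -> {subset s <= V'} -> vcycle w V' s.
Proof.
by case/and4P => h1 h2 h3 _ sub; apply/and4P; split=> //; apply/allP => x /sub.
Qed.

Lemma vcycle_mem w V s x : vcycle w V s -> x \in s -> x \in V.
Proof. by case/and4P => _ _ _ /allP H /H. Qed.

(** * Edge deletion: edges and chords of a cycle are not bridges *)

Lemma edge_delC w V x y : edge_del w V x y =2 edge_del w V y x.
Proof. by move=> a b; rewrite /edge_del /= (setUC [set x]). Qed.

Lemma edge_del_sym w V x y : is_weight w -> symmetric (edge_del w V x y).
Proof. by move=> [wC _ _] a b; rewrite /edge_del /= wC (setUC [set a]) andbCA. Qed.

Lemma connect_map (e e' : rel T) (f : T -> T) x y :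
  (forall a b, e a b -> connect e' (f a) (f b)) ->
  connect e x y -> connect e' (f x) (f y).
Proof.
move=> H /connectP[p pth ->]; elim: p x pth => [|z p IH] x /=; first by rewrite connect0.
by case/andP => /H h /IH; apply: connect_trans.
Qed.

(** A path with at least two edges does not use the edge joining its ends: its first edge does not
    reach the last vertex, and its later edges avoid [x]. *)
Lemma path_edge_del w V x p :
  all (mem V) (x :: p) -> path (posrel w) x p -> uniq (x :: p) -> (1 < size p)%N ->
  connect (edge_del w V x (last x p)) x (last x p).
Proof.
case: p => [|y [|z p]] //= /and3P[Vx Vy Vp] /and3P[xy yz pth].
rewrite !inE !negb_or => /and3P[/and3P[nxy nxz nxp] /andP[nyz nyp] /andP[nzp _]] _.
set l := last z p.
have ly : l != y.
  by apply/eqP => e; have := mem_last z p; rewrite -/l e inE (negbTE nyz) (negbTE nyp).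
apply: (@connect_trans _ _ y).
  apply: connect1; rewrite /edge_del /= Vx Vy (xy : 0 < w x y) /=.
  by apply: contraNneq ly => /setP /(_ y); rewrite !inE eqxx orbT eq_sym (negbTE nxy) /= eq_sym => <-.
apply/connectP; exists (z :: p) => //.
have: path (posrel w) y (z :: p) by rewrite /= yz pth.
apply: (@sub_in_path _ (fun a => (a \in V) && (a != x))) => [a b /andP[Va ax] /andP[Vb bx] ab|].
  rewrite /edge_del /= Va Vb (ab : 0 < w a b) /=.
  by apply/eqP => /setP /(_ x); rewrite !inE eqxx eq_sym (negbTE ax) eq_sym (negbTE bx).
apply/allP => a; rewrite inE => /predU1P[->|]; first by rewrite [_ \in _]Vy eq_sym.
have /allP Vzp : all (mem V) (z :: p) by [].
move=> ain; rewrite [_ \in V]Vzp //=; apply: contraTneq ain => ->.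
by rewrite inE negb_or nxz.
Qed.

(** The cycle splits at [x] and [y] into two paths, one of which has at least two edges. Since [x]
    and [y] need not be consecutive on [s], this covers chords as well. *)
Lemma cycle_edge_del w V s x y : is_weight w -> vcycle w V s ->
  x \in s -> y \in s -> x != y -> connect (edge_del w V x y) x y.
Proof.
move=> ww cs xs; have [n q E] := rot_to xs.
rewrite -(mem_rot n) E inE eq_sym => /predU1P[->|yq]; first by rewrite eqxx.
move: cs; rewrite -(vcycle_rot _ _ n) E.
case/splitPr: yq => q1 q2 /and4P[/= sz]; rewrite mem_cat cat_uniq /= !inE.
rewrite !negb_or => /and3P[/and3P[xq1 xy xq2] uq1 /and3P[/andP[yq1 dis] yq2 uq2]].
rewrite rcons_cat cat_path /= => /and3P[p1 p12 p2].
rewrite all_cat /= => /and4P[Vx Vq1 Vy Vq2] _.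
case: q1 => [|z q1] in sz xq1 uq1 yq1 dis p1 p12 Vq1 *.
  (* Here [y] directly follows [x], so the arc from [y] back to [x] is taken; it has an interior
     vertex because the cycle has more than two vertices. *)
  rewrite (eq_connect (edge_delC _ _ _ _)) (sym_connect_sym (edge_del_sym _ _ _ ww)).
  have := @path_edge_del w V y (rcons q2 x); rewrite last_rcons; apply=> //.
  - by rewrite /= all_rcons Vy /= [_ \in _]Vx.
  - by rewrite /= mem_rcons inE negb_or eq_sym xy yq2 rcons_uniq xq2.
  - by move: sz; rewrite size_rcons /=; case: (q2).
have := @path_edge_del w V x (rcons (z :: q1) y); rewrite last_rcons; apply.
- by rewrite -rcons_cons all_rcons; apply/and3P; split.
- by rewrite rcons_path p1.
- by rewrite cons_uniq mem_rcons inE negb_or xy xq1 rcons_uniq yq1.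
- by rewrite size_rcons.
Qed.

(** * Inserting an outside path into a cycle *)

Lemma last_take x q i : (i <= size q)%N -> last x (take i q) = nth x (x :: q) i.
Proof.
by move=> le_i; rewrite (last_nth x) size_takel // -[x :: _]/(take i.+1 (x :: q)) nth_take.
Qed.

Lemma last_take_rcons x q i : (i <= (size q).+1)%N ->
  last x (take i (rcons q x)) = nth x (x :: q) i.
Proof.
by move=> le_i; rewrite last_take ?size_rcons // -rcons_cons nth_rcons_default.
Qed.

Lemma rcons_drop x q j : (j <= (size q).+1)%N ->
  rcons (drop j (x :: q)) x = nth x (x :: q) j :: drop j (rcons q x).
Proof.
move=> le_j; rewrite -drop_rcons // (drop_nth x) ?size_rcons //=.
by rewrite -rcons_cons nth_rcons_default.
Qed.

(* Position [size (x :: q)] stands for the return to [x], which is also the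
   default value of [nth x]. *)
Lemma splice w V x q v t i j (f := nth x (x :: q))
    (S := fun k => pathw w x (take k (rcons q x)))
    (s' := x :: take i q ++ (v :: t) ++ drop j (x :: q)) :
  vcycle w V (x :: q) -> (i < j)%N -> (j <= (size q).+1)%N ->
  (0 < i)%N || (j < (size q).+1)%N ->
  path (posrel w) v t -> uniq (v :: t) -> {subset v :: t <= V} ->
  (forall y, y \in v :: t -> y \notin x :: q) ->
  0 < w (f i) v -> 0 < w (last v t) (f j) ->
  vcycle w V s' /\
  cyclew w s' = S i + (w (f i) v + pathw w v t + w (last v t) (f j))
                + (cyclew w (x :: q) - S j).
Proof.
move=> /and4P[sz us ps /allP Vs] ij jn nz pt ut Vt dis iv uj.
have iq : (i <= size q)%N by rewrite -ltnS (leq_trans ij).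
have lasti : last x (take i q) = f i by exact: last_take.
have Si : S i = pathw w x (take i q) by rewrite /S -cats1 takel_cat.
have Sj : cyclew w (x :: q) - S j = pathw w (f j) (drop j (rcons q x)).
  rewrite /= -{1}(cat_take_drop j (rcons q x)) pathw_cat last_take_rcons //.
  by rewrite addrC addKr.
have catE : s' = take i.+1 (x :: q) ++ (v :: t) ++ drop j (x :: q) by [].
have rconsE : rcons (take i q ++ (v :: t) ++ drop j (x :: q)) x =
    take i q ++ (v :: t) ++ f j :: drop j (rcons q x).
  by rewrite !rcons_cat rcons_drop.
split; last first.
  by rewrite /s' /cyclew rconsE !pathw_cat lasti /= -Si -Sj !addrA.
apply/and4P; split.
(* Were [i] zero and [j] the closing position, only [x] and the inserted path would remain, which is
   too short when [t] is empty; [nz] excludes this. *)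
- rewrite catE !size_cat size_takel ?size_drop //= ; move: nz sz => /=.
  clear -ij jn; lia.
- rewrite catE uniq_catCA cat_uniq; apply/and3P; split=> //.
    apply/hasPn => y; rewrite mem_cat => yin; apply/negP => /dis /negP; apply.
    by case/orP: yin => [/mem_take|/mem_drop].
  apply: subseq_uniq us.
  rewrite -[X in subseq _ X](cat_take_drop j); apply: cat_subseq => //.
  by rewrite -(take_takel _ ij) take_subseq.
- rewrite /s' /path.cycle rconsE !cat_path lasti /=.
  move: ps => /=; rewrite -{1}(cat_take_drop j (rcons q x)) cat_path.
  rewrite last_take_rcons // => /andP[ptake pdrop].
  rewrite -andbA; apply/and5P; split => //.
  have := take_path i ptake; rewrite take_takel ?(ltnW ij) //.
  by rewrite -cats1 takel_cat.
- apply/allP => y; rewrite catE !mem_cat => /or3P[/mem_take|/Vt//|/mem_drop]; exact: Vs.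
Qed.

(** * Rerouting a heaviest non-spanning cycle *)

Lemma sum_nbrs w v x q :
  \sum_(y <- x :: q) w v y = \sum_(0 <= k < (size q).+1) w v (nth x (x :: q) k).
Proof. by rewrite (big_nth x). Qed.

Lemma sum_single (F : T -> R) s a : uniq s -> a \in s ->
  {in s, forall y, y != a -> F y = 0} -> \sum_(y <- s) F y = F a.
Proof.
move=> us sa H; rewrite (bigD1_seq a) //= big_seq_cond big1 ?addr0 // => y.
by case/andP => sy ya; apply: H.
Qed.

(** The spliced cycle trades the arc from [i] to [j] for the detour and weighs at most [M]. Only
    cycles inside the path and the old cycle are compared with [M], so [M] can be the weight of a
    heaviest non-spanning cycle when some vertex is still missed, and [c] otherwise. *)
Lemma arc_le w V x q v t M i j (f := nth x (x :: q))
    (S := fun k => pathw w x (take k (rcons q x))) :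
  vcycle w V (x :: q) -> (i < j)%N -> (j <= (size q).+1)%N ->
  (0 < i)%N || (j < (size q).+1)%N ->
  path (posrel w) v t -> uniq (v :: t) -> {subset v :: t <= V} ->
  (forall y, y \in v :: t -> y \notin x :: q) ->
  (forall s', vcycle w V s' -> {subset s' <= (v :: t) ++ x :: q} -> cyclew w s' <= M) ->
  0 < w (f i) v -> 0 < w (last v t) (f j) ->
  w (f i) v + pathw w v t + w (last v t) (f j) - (M - cyclew w (x :: q)) <= S j - S i.
Proof.
move=> cs ij jn nz pt ut Vt dis HM iv uj.
have [cs' e] := splice cs ij jn nz pt ut Vt dis iv uj.
have := HM _ cs'; rewrite e -/f -/(S i) -/(S j) => h.
suff sub : {subset x :: take i q ++ (v :: t) ++ drop j (x :: q) <= (v :: t) ++ x :: q}.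
  by have := h sub; lra.
move=> y; rewrite -cat_cons -[x :: take _ _]/(take i.+1 (x :: q)) !mem_cat.
by case/or3P => [/mem_take->|->//|/mem_drop->]; rewrite orbT.
Qed.

(** Inserting [v] between successive neighbours bounds the two edge weights by the arc plus the
    excess [M - cyclew w s]. Summing round the cycle counts each edge at [v] twice and the excess at
    most [size s] times. *)
Lemma star_bound w V s v M : is_weight w -> vcycle w V s -> v \in V -> v \notin s ->
  (forall s', vcycle w V s' -> {subset s' <= v :: s} -> cyclew w s' <= M) ->
  forall a b, a \in s -> b \in s -> a != b -> 0 < w v a -> 0 < w v b ->
  2 * (\sum_(y <- s) w v y) <= cyclew w s + (size s)%:R * (M - cyclew w s).
Proof.
move=> ww cs Vv vs HM a b sa; have [wC w0 wge0] := ww.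
have [r q E] := rot_to sa.
have Eperm : perm_eq (rot r s) s by rewrite perm_rot.
have memE : rot r s =i s by exact: mem_rot.
rewrite -(perm_big _ Eperm) -(cyclew_rot w r) -(size_rot r) -memE /=.
move: cs vs HM; rewrite -(vcycle_rot _ _ r) -memE E => cs vs HM sb ab va vb.
set n := size (a :: q).
pose f := nth a (a :: q).
pose S k := pathw w a (take k (rcons q a)).
pose h := M - cyclew w (a :: q).
have h0 : 0 <= h.
  by rewrite subr_ge0 HM // => y ys; rewrite inE -memE E ys orbT.
pose P k := 0 < w v (f k).
have jb : f (index b (a :: q)) = b by apply: nth_index.
have jn : (0 < index b (a :: q) < n)%N by rewrite index_mem sb andbT /= (negbTE ab).
have fn : f n = a by apply: nth_default.
(* The excess [h] of an arc is shared equally between its two ends, which puts the arc bound in the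
   form that [circle_sum] expects. *)
have := @circle_sum _ S (fun k => w v (f k) - h / 2) P n (index b (a :: q)) jn.
rewrite /P fn jb => /(_ va vb va erefl) H.
have {H} H : 2 * \sum_(0 <= k < n | 0 < w v (f k)) (w v (f k) - h / 2) <= S n - S 0%N.
  apply: H => k l kl ln nz vk vl.
  have /= := @arc_le w V a q v [::] M k l cs kl ln nz isT isT.
  rewrite -/h -/(S k) -/(S l) (wC _ v) addr0 => arc.
  suff : w v (f k) + w v (f l) - h <= S l - S k by lra.
  apply: arc => //.
  - by move=> y; rewrite inE => /eqP->.
  - by move=> y; rewrite inE => /eqP->.
  - move=> s' cs' sub; apply: HM => // y /sub; rewrite !inE -memE E inE //.
have Sn : S n = cyclew w (a :: q) by rewrite /S take_oversize // size_rcons.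
have S0 : S 0%N = 0 by rewrite /S take0.
have sumP : \sum_(0 <= k < n | 0 < w v (f k)) w v (f k) = \sum_(y <- a :: q) w v y.
  rewrite sum_nbrs -/f -/n [RHS](bigID P) /= [X in _ = _ + X]big1 ?addr0 // => k.
  by rewrite /P -leNgt => vk; apply/eqP; rewrite eq_le vk wge0.
have cardP : \sum_(0 <= k < n | 0 < w v (f k)) (h / 2) <= n%:R * (h / 2).
  have -> : n%:R * (h / 2) = \sum_(0 <= k < n) (h / 2).
    by rewrite sumr_const_nat subn0 mulr_natl.
  rewrite [leRHS](bigID P) /= lerDl sumr_ge0 // => k _; lra.
move: H; rewrite sumrB sumP Sn S0 -/h; lra.
Qed.

Lemma sum_nbrs_other w s v a : is_weight w -> uniq s -> a \in s ->
  (exists2 y, y \in s & (y != a) && (0 < w v y)) \/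
  {in s, forall y, 0 < w v y -> y = a} /\ \sum_(y <- s) w v y = w v a.
Proof.
move=> [_ _ wge0] us sa.
have [/hasP[y ys yP]|/hasPn no] := boolP (has (fun y => (y != a) && (0 < w v y)) s).
  by left; exists y.
right; split=> [y /no|]; first by rewrite negb_and negbK => /orP[/eqP|/negP].
apply: sum_single => // y ys ya.
by have := no y ys; rewrite ya /= -leNgt => vy; apply/eqP; rewrite eq_le vy wge0.
Qed.

(** * Attaching the two ends of an outside path to a heaviest non-spanning cycle *)

Section Detour.
Variables (w : T -> T -> R) (V : {set T}) (c : R) (v : T) (t : seq T).
Hypothesis ww : is_weight w.
Hypothesis le_c : forall s, vcycle w V s -> cyclew w s <= c.
Hypotheses (pt : path (posrel w) v t) (ut : uniq (v :: t)) (tN0 : t != [::]).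
Hypothesis Vt : {subset v :: t <= V}.

Let u := last v t.

Let t_ends : [/\ v \in V, u \in V & v != u].
Proof.
have ut' : u \in t by rewrite /u; case: (t) tN0 => //= y r _; apply: mem_last.
split; first by rewrite Vt // mem_head.
  by rewrite Vt // inE ut' orbT.
by apply: contraTneq ut' => <-; case/andP: ut.
Qed.

Definition heaviest_nonspanning s := forall s' y,
  vcycle w V s' -> y \in V -> y \notin s' -> cyclew w s' <= cyclew w s.

(** Inserting only one end of the path leaves the other end off the cycle, so maximality applies
    with no loss. Inserting the whole path may give a spanning cycle, bounded only by [c]; hence the
    correction [c - cyclew w (x :: q)], which can make the last parameter negative. *)
Lemma detour_arcs x q : vcycle w V (x :: q) -> heaviest_nonspanning (x :: q) ->
  (forall y, y \in v :: t -> y \notin x :: q) ->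
  forall k l, (k < l)%N -> (l <= (size q).+1)%N -> (0 < k)%N || (l < (size q).+1)%N ->
  arcs_bounded (fun k => pathw w x (take k (rcons q x)))
    (fun k => w v (nth x (x :: q) k)) (fun k => w u (nth x (x :: q) k))
    (pathw w v t - (c - cyclew w (x :: q))) k l.
Proof.
move=> cs Hs dis i j ij jn nz k l ik kl lj.
have {}jn := leq_trans lj jn.
have {}nz : (0 < k)%N || (l < (size q).+1)%N.
  by case/orP: nz => [i0|jn']; rewrite ?(leq_trans i0 ik) // (leq_ltn_trans lj jn') orbT.
have [wC _ wge0] := ww; have [Vv Vu vu] := t_ends.
have us : u \notin x :: q by apply: dis; rewrite /u mem_last.
have vs : v \notin x :: q by apply: dis; rewrite mem_head.
have star z z' : z \in V -> z' \in V -> z \notin x :: q -> z' \notin x :: q -> z != z' ->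
    0 < w z (nth x (x :: q) k) -> 0 < w z (nth x (x :: q) l) ->
    w z (nth x (x :: q) k) + w z (nth x (x :: q) l) <=
    pathw w x (take l (rcons q x)) - pathw w x (take k (rcons q x)).
  move=> Vz Vz' sz sz' zz' zk zl.
  have := @arc_le w V x q z [::] (cyclew w (x :: q)) k l cs kl jn nz isT isT.
  rewrite subrr subr0 addr0 (wC _ z); apply=> //.
  - by move=> y; rewrite inE => /eqP->.
  - by move=> y; rewrite inE => /eqP->.
  - move=> s' cs' sub; apply: (Hs s' z') => //; apply/negP => /sub.
    by rewrite mem_cat (negbTE sz') inE eq_sym (negbTE zz').
split.
- exact: star Vv Vu vs us vu.
- by apply: star Vu Vv us vs _; rewrite eq_sym.
- move=> vk ul.
  have := @arc_le w V x q v t c k l cs kl jn nz pt ut Vt dis (fun s' h _ => le_c h).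
  rewrite (wC _ v) => /(_ vk ul); rewrite -/u; lra.
- move=> uk vl.
  (* When the arc starts at a neighbour of [u], the path is inserted backwards. *)
  have revE : u :: rev (belast v t) = rev (v :: t) by rewrite (lastI v t) rev_rcons.
  have lastE : last u (rev (belast v t)) = v.
    by rewrite /u; case: (t) tN0 => //= y r _; rewrite rev_cons last_rcons.
  have := @arc_le w V x q u (rev (belast v t)) c k l cs kl jn nz.
  rewrite revE rev_uniq pathw_rev // lastE (wC _ u) -/u => arc.
  suff: w u (nth x (x :: q) k) + pathw w v t + w v (nth x (x :: q) l)
    - (c - cyclew w (x :: q)) <= pathw w x (take l (rcons q x)) - pathw w x (take k (rcons q x)).
    lra.
  apply: arc => //.
  + by rewrite /u rev_path; apply: sub_path pt => a b; rewrite /posrel wC.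
  + by move=> y; rewrite mem_rev; apply: Vt.
  + by move=> y; rewrite mem_rev; apply: dis.
  + by move=> s' cs' _; apply: le_c.
Qed.

(** Cycles obtained by inserting [z] still miss [z'], so [star_bound] applies with [M] the weight of
    [s], and its error term vanishes. *)
Lemma star_le s z z' : vcycle w V s -> heaviest_nonspanning s ->
  z \in V -> z' \in V -> z \notin s -> z' \notin s -> z != z' ->
  forall a b, a \in s -> b \in s -> a != b -> 0 < w z a -> 0 < w z b ->
  2 * (\sum_(y <- s) w z y) <= cyclew w s.
Proof.
move=> cs Hs Vz Vz' zs zs' zz' a b sa sb ab za zb.
have := star_bound ww cs Vz zs _ sa sb ab za zb (M := cyclew w s).
rewrite subrr mulr0 addr0; apply=> s' cs' sub; apply: (Hs s' z') => //.
by apply/negP => /sub; rewrite inE (negbTE zs') eq_sym (negbTE zz').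
Qed.

(** The vertices [x] and [b] cut the cycle into two arcs. The excess [d] of the path weight over
    [c - cyclew w (x :: q)] has to be earned once by rerouting; the argument depends on its sign. *)
Lemma detour_pair x q b : vcycle w V (x :: q) -> heaviest_nonspanning (x :: q) ->
  (forall y, y \in v :: t -> y \notin x :: q) ->
  b \in x :: q -> b != x -> 0 < w v x -> 0 < w u b ->
  \sum_(y <- x :: q) w v y + pathw w v t + \sum_(y <- x :: q) w u y <= c.
Proof.
move=> cs Hs dis sb bx vx ub.
have [wC _ wge0] := ww; have [Vv Vu vu] := t_ends.
have us : u \notin x :: q by apply: dis; rewrite /u mem_last.
have vs : v \notin x :: q by apply: dis; rewrite mem_head.
have uniq_s : uniq (x :: q) by case/and4P: cs.
have sx : x \in x :: q by rewrite mem_head.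
have xb : x != b by rewrite eq_sym.
have uv : u != v by rewrite eq_sym.
have := detour_arcs cs Hs dis.
set n := (size q).+1; set f := nth x (x :: q).
set S := fun k => pathw w x (take k (rcons q x)).
set d := pathw w v t - _ => arcs.
set j := index b (x :: q).
have fj : f j = b by apply: nth_index.
have j0 : (0 < j)%N by rewrite /j /= (negbTE xb).
have jn : (j < n)%N by rewrite index_mem.
have f0 : f 0%N = x by [].
have fn : f n = x by apply: nth_default.
have Sn : S n = cyclew w (x :: q) by rewrite /S take_oversize // size_rcons.
have S0 : S 0%N = 0 by rewrite /S take0.
have arc1 : arcs_bounded S (fun k => w v (f k)) (fun k => w u (f k)) d 0 j.
  by apply: arcs; rewrite ?(ltnW jn) ?jn ?orbT.
have arc2 : arcs_bounded S (fun k => w v (f k)) (fun k => w u (f k)) d j n.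
  by apply: arcs; rewrite // j0.
have dE : pathw w v t = d + (c - cyclew w (x :: q)) by rewrite /d subrK.
have cs_c := le_c cs.
(* For nonnegative [d], the first arc switches from [v] to [u] and earns [d], using [v] at [x] and
   [u] at [b]; the maxima at the ends of the second arc leave room for the other two terms, [v] at
   [b] and [u] at [x]. *)
have [d0|d0] := leP 0 d.
  have h1 := @chain_sum_switch _ S _ _ d 0 j d0 (fun k => wge0 v (f k))
    (fun k => wge0 u (f k)) j0.
  have {}h1 : w v x + w u b + d + \sum_(1 <= k < j) (w v (f k) + w u (f k)) <= S j - S 0%N.
    by rewrite -fj; apply: h1 => //; rewrite fj.
  have h2 := @chain_sum_max _ S _ _ d j n d0 (fun k => wge0 v (f k))
    (fun k => wge0 u (f k)) jn.
  have {}h2 : w v b + w u x + \sum_(j.+1 <= k < n) (w v (f k) + w u (f k)) <= S n - S j.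
    apply: le_trans (h2 _ _ arc2); last 2 first.
    - by rewrite fj ub orbT.
    - by rewrite fn vx.
    by rewrite lerD2r fj fn; apply: lerD; rewrite le_max lexx ?orbT.
  have E : \sum_(y <- x :: q) w v y + \sum_(y <- x :: q) w u y =
    (w v x + w u x) + (\sum_(1 <= k < j) (w v (f k) + w u (f k)) + (w v b + w u b)
      + \sum_(j.+1 <= k < n) (w v (f k) + w u (f k))).
    rewrite !sum_nbrs -big_split /= -/f -/n big_ltn // f0; congr (_ + _).
    by rewrite (@sum_split_at _ _ predT 0 j n) ?j0 // fj.
  move: h1 h2; rewrite Sn S0; lra.
(* For negative [d], inserting the whole path in either arc bounds the single edges [vx] and [ub]. A
   vertex with a further neighbour on the cycle has star weight at most half the cycle by [star_le];
   otherwise its star is that single edge. *)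
have [_ _ a1 _] := arc1 0%N j (leqnn _) j0 (leqnn _).
have [_ _ _ a2] := arc2 j n (leqnn _) jn (leqnn _).
have {}a1 : w v x + w u b + d <= S j - S 0%N by rewrite -fj; apply: a1; rewrite ?fj.
have {}a2 : w u b + w v x + d <= S n - S j.
  by rewrite -fj -[in w v x]fn; apply: a2; rewrite ?fj ?fn.
have {a1 a2} aa : 2 * (w v x + w u b + d) <= cyclew w (x :: q).
  by rewrite -Sn; rewrite S0 in a1; clear -a1 a2; lra.
have starv := star_le cs Hs Vv Vu vs us vu.
have staru := star_le cs Hs Vu Vv us vs uv.
have wvx := wge0 v x; have wub := wge0 u b.
have cs0 := cyclew_ge0 (x :: q) ww.
case: (sum_nbrs_other v ww uniq_s sx) => [[y ys /andP[yx vy]]|[_ ->]];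
  case: (sum_nbrs_other u ww uniq_s sb) => [[z zs /andP[zb uz]]|[_ ->]].
- have h1 := starv _ _ ys sx yx vy vx; have h2 := staru _ _ zs sb zb uz ub; lra.
- have h1 := starv _ _ ys sx yx vy vx; lra.
- have h2 := staru _ _ zs sb zb uz ub; lra.
- lra.
Qed.

(** If [v] and [u] have distinct neighbours on [s], rotation reduces to [detour_pair]. Otherwise
    both see only one vertex [a], and [a :: v :: t] is itself a cycle of the required weight. *)
Lemma detour_bound s : vcycle w V s -> heaviest_nonspanning s ->
  (forall y, y \in v :: t -> y \notin s) ->
  0 < \sum_(y <- s) w v y -> 0 < \sum_(y <- s) w u y ->
  \sum_(y <- s) w v y + pathw w v t + \sum_(y <- s) w u y <= c.
Proof.
move=> cs Hs dis dv du.
have [wC _ wge0] := ww; have [Vv Vu vu] := t_ends.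
have uniq_s : uniq s by case/and4P: cs.
have pair a b : a \in s -> b \in s -> b != a -> 0 < w v a -> 0 < w u b ->
    \sum_(y <- s) w v y + pathw w v t + \sum_(y <- s) w u y <= c.
  move=> sa sb ba va ub; have [r q E] := rot_to sa.
  have Eperm : perm_eq (rot r s) s by rewrite perm_rot.
  rewrite -!(perm_big _ Eperm) E /=; apply: detour_pair ub => //.
  - by rewrite -E vcycle_rot.
  - by move=> s' y; rewrite -E cyclew_rot; apply: Hs.
  - by move=> y /dis; rewrite -E mem_rot.
  - by rewrite -E mem_rot.
have nbr z : 0 < \sum_(y <- s) w z y -> exists2 a, a \in s & 0 < w z a.
  move=> dz; have [/hasP[a sa za]|/hasPn no] := boolP (has (fun a => 0 < w z a) s).
    by exists a.
  move: dz; rewrite big_seq big1 ?ltxx // => y /no; rewrite -leNgt => zy.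
  by apply/eqP; rewrite eq_le zy wge0.
have [a sa va] := nbr _ dv.
case: (sum_nbrs_other u ww uniq_s sa) => [[y ys /andP[ya uy]]|[_ Eu]].
  exact: pair ys ya va uy.
have ua : 0 < w u a by rewrite -Eu.
case: (sum_nbrs_other v ww uniq_s sa) => [[y ys /andP[ya vy]]|[_ Ev]].
  by apply: (pair y a) => //; rewrite eq_sym.
rewrite Ev Eu.
have aV := vcycle_mem cs sa.
have at' : a \notin v :: t by apply: contraTN sa => /dis.
have ca : vcycle w V (a :: v :: t).
  apply/and4P; split.
  - by case: (t) tN0.
  - by rewrite cons_uniq at'.
  - rewrite /= rcons_path pt /posrel -/u ua andbT wC va //.
  - by apply/allP => y; rewrite inE => /predU1P[->//|/Vt].
have := le_c ca; rewrite /= pathw_rcons -/u (wC a) addrA //.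
Qed.

End Detour.

(** * Contraction of a cycle and the induction *)

(** Ordered pairs count every edge twice, so this is twice the total edge weight; the bounds on it
    therefore carry no factor one half. *)
Definition gweight w V : R := \sum_(x in V) \sum_(y in V) w x y.

Lemma gweight_split w V A : is_weight w -> A \subset V ->
  gweight w V = gweight w A + gweight w (V :\: A)
                + 2 * \sum_(x in A) \sum_(y in V :\: A) w x y.
Proof.
move=> [wC _ _] AV; rewrite /gweight.
have VA : V :&: A = A by apply/setIidPr.
rewrite (big_setID A) /= VA.
under eq_bigr do rewrite (big_setID A) /= VA.
under [X in _ + X = _]eq_bigr do rewrite (big_setID A) /= VA.
rewrite !big_split /= [X in _ + (X + _)]exchange_big /=.
under [X in _ + (X + _)]eq_bigr => x _ do under eq_bigr => y _ do rewrite wC.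
by ring.
Qed.

(** All edges leaving [A] leave from [x], so sending everything outside [A] to [x] turns a walk
    avoiding [ab] into such a walk inside [A]. *)
Lemma admissible_part w V A c x : admissible w V c -> A \subset V -> x \in A ->
  (forall k l, k \in A -> l \in V -> l \notin A -> 0 < w k l -> k = x) ->
  (forall k l, k \in A -> l \in V -> l \notin A -> 0 < w l k -> k = x) ->
  admissible w A c.
Proof.
move=> [c0 cyc bri] /subsetP AV Ax out inn; split=> // [s cs|a b Aa Ab ab].
  by apply/cyc/(vcycle_subset cs) => y /(vcycle_mem cs) /AV.
case: (bri a b (AV _ Aa) (AV _ Ab) ab) => [con|?]; [left|by right].
pose f k := if k \in A then k else x.
have := @connect_map (edge_del w V a b) (edge_del w A a b) f a b.
rewrite /f Aa Ab; apply=> // k l /and4P[Vk Vl kl ne].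
case: ifP => Ak; case: ifP => Al //.
- by apply: connect1; rewrite /edge_del /= Ak Al kl.
- by rewrite (out k l) ?Al.
- by rewrite (inn l k) ?Ak.
Qed.

(** A simple path from [x] to [y] avoiding the edge [xy] is closed by that edge; it has at least two
    edges because its only one-edge candidate was deleted. *)
Lemma exists_vcycle w V x y : is_weight w -> x \in V -> 0 < w x y ->
  connect (edge_del w V x y) x y -> exists s, vcycle w V s.
Proof.
move=> [wC w0 _] Vx xy /connectP[p0 pth Ey].
case: (shortenP pth) Ey => p {}pth up _ Ey; exists (x :: p).
have pV : all (mem V) p.
  elim: p x {2}x {Vx xy Ey up} pth => //= z p IH x a /andP[/and4P[_ Vz _ _] h].
  by rewrite [_ \in _]Vz (IH x z).
apply/and4P; split=> //.
- case: p Ey pth {up pV} => [|z [|]] //=; first by move=> E; rewrite E w0 ltxx in xy.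
  by move=> ->; rewrite /edge_del /= eqxx !andbF.
- rewrite /= rcons_path -Ey /posrel wC xy andbT.
  by apply: sub_path pth => a b /and4P[].
- by rewrite /= Vx.
Qed.

(** * Spanning and non-spanning cycles *)

Lemma pathw_nth w d x p :
  pathw w x p = \sum_(0 <= k < size p) w (nth d (x :: p) k) (nth d p k).
Proof.
elim: p x => [|y p IH] x; first by rewrite big_geq.
by rewrite [size _]/= big_nat_recl //= IH.
Qed.

Lemma cyclew_next w s : uniq s -> cyclew w s = \sum_(x <- s) w x (next s x).
Proof.
case: s => [|x p] us; first by rewrite big_nil.
rewrite /cyclew (pathw_nth w x) size_rcons (big_nth x).
apply: eq_big_nat => k kn.
rewrite -rcons_cons !nth_rcons_default next_nth mem_nth // index_uniq //.
Qed.

(** A chord [xy] would close one arc of [s] into a cycle missing a vertex of the other arc. *)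
Lemma cycle_nbr w V s x y : is_weight w -> vcycle w V s ->
  (forall s', vcycle w V s' -> {subset V <= s'}) ->
  x \in s -> y \in s -> 0 < w x y -> y = next s x \/ x = next s y.
Proof.
move=> [wC w0 _] cs span xs ys xy; have [r q E] := rot_to xs.
have us : uniq s by case/and4P: cs.
rewrite -(next_rot r us x) -(next_rot r us y) E.
move: ys cs; rewrite -(mem_rot r) -(vcycle_rot _ _ r) E inE => /predU1P[e|yq].
  by rewrite e w0 ltxx in xy.
case/splitPr: yq {E} => -[|z q1] [|z' q2] cs; try solve [left; rewrite /= eqxx //].
  right; rewrite next_nth; have {cs} /and4P[_ uq _ _] := cs.
  have yn : y \notin x :: z :: q1.
    by move: uq; rewrite -cat_cons cats1 rcons_uniq => /andP[].
  have -> : y \in x :: (z :: q1) ++ [:: y] by rewrite -cat_cons mem_cat mem_head orbT.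
  rewrite -cat_cons index_cat (negbTE yn) /= eqxx addn0 nth_default //.
  by rewrite size_cat /= addn1.
have := cs; rewrite -cat_rcons -cat_cons => /and4P[_ uq pq Vq].
move: uq Vq; rewrite cat_uniq all_cat => /and3P[u1 dis _] /andP[V1 /andP[zV _]].
have cs' : vcycle w V (x :: rcons (z :: q1) y).
  apply/and4P; split=> //; first by rewrite /= size_rcons.
  move: pq; rewrite /= rcons_cat cat_path => /and3P[-> h1 _].
  by rewrite rcons_path h1 last_rcons /posrel wC xy.
by move: dis; rewrite /= negb_or (span _ cs' _ zV).
Qed.

Lemma spanning_cycle_weight w V s : is_weight w -> vcycle w V s ->
  (forall s', vcycle w V s' -> {subset V <= s'}) -> gweight w V <= 2 * cyclew w s.
Proof.
move=> ww cs span; have [wC w0 wge0] := ww.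
have us : uniq s by case/and4P: cs.
have Vs : V =i s.
  by move=> x; apply/idP/idP => [|/(vcycle_mem cs)//]; apply: span.
have sumV (F : T -> R) : \sum_(x in V) F x = \sum_(x <- s) F x.
  by rewrite big_uniq //=; apply: eq_bigl => x; rewrite Vs.
(* Each edge of the cycle is spread over its two ordered pairs, so that the comparison with
   [gweight] can be made pair by pair. *)
have -> : 2 * cyclew w s = \sum_(x in V) \sum_(y in V)
    ((if y == next s x then w x y else 0) + (if x == next s y then w x y else 0)).
  under eq_bigr do rewrite big_split /=.
  rewrite big_split /= [X in _ = _ + X]exchange_big /= mulr_natl mulr2n.
  congr (_ + _); rewrite cyclew_next // -sumV; apply: eq_bigr => x Vx.
    rewrite -big_mkcondr /= (big_pred1 (next s x)) // => y.
    by apply: andb_idl => /eqP->; rewrite Vs mem_next -Vs.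
  rewrite -big_mkcondr /= (big_pred1 (next s x)) 1?wC // => y.
  by apply: andb_idl => /eqP->; rewrite Vs mem_next -Vs.
apply: ler_sum => x Vx; apply: ler_sum => y Vy.
have pos b : 0 <= (if b then w x y else 0) by case: b.
have [xy|xy] := ltP 0 (w x y); last by apply: le_trans xy _; rewrite addr_ge0.
rewrite !Vs in Vx Vy.
have [/eqP->|/eqP->] := cycle_nbr ww cs span Vx Vy xy; first by rewrite lerDl.
by rewrite lerDr.
Qed.

(** Cycles have no repeated vertex, so they live in the finite type of sequences of length at most
    [#|T|], where a maximum exists. *)
Lemma exists_heaviest_nonspanning w V s y : vcycle w V s -> y \in V -> y \notin s ->
  exists s0 y0, [/\ vcycle w V s0, y0 \in V, y0 \notin s0 & heaviest_nonspanning w V s0].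
Proof.
move=> cs Vy ys.
have szle s' : vcycle w V s' -> (size s' <= #|T|)%N.
  by case/and4P => _ us' _ _; rewrite -(card_uniqP us') max_card.
pose P (b : #|T|.-bseq T) := vcycle w V b && [exists y, (y \in V) && (y \notin val b)].
have Pmk s' y' (cs' : vcycle w V s') : y' \in V -> y' \notin s' -> P (Bseq (szle _ cs')).
  by move=> Vy' ys'; rewrite /P /= cs'; apply/existsP; exists y'; rewrite Vy'.
have [b /andP[cb /existsP[z /andP[Vz zb]]] bmax] :=
  arg_maxP (fun b : #|T|.-bseq T => cyclew w b) (Pmk _ _ cs Vy ys).
exists b, z; split=> // s' y' cs' Vy' ys'.
exact: (bmax _ (Pmk _ _ cs' Vy' ys')).
Qed.

(** * Contracting a cycle to one vertex *)

(** The vertex [z] stands for the whole of [s]: parallel edges are merged by adding their weights,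
    and the loop at [z] gets weight zero. *)
Definition contractw w (s : seq T) (z x y : T) : R :=
  if x == z then (if y == z then 0 else \sum_(a <- s) w y a)
  else if y == z then \sum_(a <- s) w x a else w x y.

Lemma contractw_weight w s z : is_weight w -> is_weight (contractw w s z).
Proof.
move=> [wC w0 wge0]; split=> [x y|x|x y]; rewrite /contractw.
- by do 2!case: eqP => //.
- by case: eqP.
- by do 2!case: eqP => _ //; rewrite sumr_ge0.
Qed.

Lemma gweight_contract w s z (B : {set T}) : is_weight w -> z \notin B ->
  gweight (contractw w s z) (z |: B) =
  gweight w B + 2 * \sum_(x in B) \sum_(a <- s) w x a.
Proof.
move=> ww zB; have nz x : x \in B -> (x == z) = false.
  by move=> Bx; apply: contraNF zB => /eqP <-.
have -> : z |: B = B :|: [set z] by rewrite setUC.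
rewrite (gweight_split (contractw_weight s z ww) (subsetUl B [set z])).
have -> : (B :|: [set z]) :\: B = [set z].
  apply/setP => x; rewrite !inE; case: eqP => [->|_]; first by rewrite zB orbT.
  by rewrite orbF andNb.
have -> : gweight (contractw w s z) [set z] = 0.
  by rewrite /gweight big_set1 big_set1 /contractw eqxx.
rewrite addr0; congr (_ + 2 * _).
  by apply: eq_bigr => x Bx; apply: eq_bigr => y By; rewrite /contractw !nz.
by apply: eq_bigr => x Bx; rewrite big_set1 /contractw nz // eqxx.
Qed.

Section Contraction.
Variables (w : T -> T -> R) (V : {set T}) (c : R) (s : seq T) (z : T).
Hypotheses (ww : is_weight w) (cs : vcycle w V s).
Hypothesis le_c : forall s', vcycle w V s' -> cyclew w s' <= c.
Hypothesis bridgeless : forall x y, x \in V -> y \in V -> 0 < w x y ->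
  connect (edge_del w V x y) x y.
Hypothesis heavy : heaviest_nonspanning w V s.
Hypothesis zs : z \in s.

Let B := V :\: [set x in s].
Hypothesis two_out : forall x, x \in B -> exists2 y, y \in B & x != y.

Let w' := contractw w s z.
(** The contraction map, along which walks of the original graph are pushed forward. *)
Let f k := if k \in B then k else z.

Let BE x : (x \in B) = (x \notin s) && (x \in V).
Proof. by rewrite !inE. Qed.

Let BV : {subset B <= V}.
Proof. by move=> x; rewrite BE => /andP[]. Qed.

Let Bs x : x \in B -> x \notin s.
Proof. by rewrite BE => /andP[]. Qed.

Let zB : z \notin B.
Proof. by rewrite BE zs. Qed.

Let nz x : x \in B -> (x == z) = false.
Proof. by move=> Bx; apply: contraNF zB => /eqP <-. Qed.

Let w'B x y : x \in B -> y \in B -> w' x y = w x y.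
Proof. by move=> Bx By; rewrite /w' /contractw !nz. Qed.

Let w'z x : x \in B -> w' x z = \sum_(a <- s) w x a.
Proof. by move=> Bx; rewrite /w' /contractw nz // eqxx. Qed.

Let fV k : f k \in z |: B.
Proof. by rewrite /f; case: ifP => Bk; rewrite in_setU1 ?eqxx // Bk orbT. Qed.

Let contract_edge a b : a \in V -> b \in V -> 0 < w a b ->
  f a = f b \/ 0 < w' (f a) (f b).
Proof.
have [wC _ wge0] := ww.
have pos x y : x \in B -> y \in V -> y \notin B -> 0 < w x y -> 0 < w' x z.
  move=> Bx Vy By xy; rewrite w'z //; have sy : y \in s.
    by move: By; rewrite BE Vy andbT negbK.
  rewrite (bigD1_seq y) //=; last by case/and4P: cs.
  by apply: ltr_pwDl => //; apply: sumr_ge0.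
have [w'C _ _] : is_weight w' := contractw_weight s z ww.
move=> Va Vb ab; rewrite /f; case: ifP => Ba; case: ifP => Bb; [| | |by left]; right.
- by rewrite w'B.
- by apply: pos ab; rewrite ?Bb.
- by rewrite w'C; apply: (pos b a); rewrite ?Ba // wC.
Qed.

(** The premise says that only [xy] is mapped onto [x'y'], so the image of a walk avoiding the
    former avoids the latter; edges with both ends on [s] collapse. *)
Let contract_connect x y x' y' :
  (forall a b, a \in V -> b \in V -> 0 < w a b -> f a != f b ->
     [set f a; f b] = [set x'; y'] -> [set a; b] = [set x; y]) ->
  connect (edge_del w V x y) x y ->
  connect (edge_del w' (z |: B) x' y') (f x) (f y).
Proof.
move=> H; apply: connect_map => a b /and4P[Va Vb ab ne].
have [->//|fab] := eqVneq (f a) (f b).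
apply: connect1; rewrite /edge_del /= !fV /=.
case: (contract_edge Va Vb ab) => [e|->/=]; first by rewrite e eqxx in fab.
by apply: contraNneq ne => e; apply/eqP/H.
Qed.

(** A cycle missing [z] is a cycle of the original graph. A cycle through [z] is a path in [B]
    closed by the stars of its two ends, which is the situation of [detour_bound]. *)
Let contract_cycle s' : vcycle w' (z |: B) s' -> cyclew w' s' <= c.
Proof.
move=> cs'; have [w'C _ _] : is_weight w' := contractw_weight s z ww.
have [zs'|zs'] := boolP (z \in s'); last first.
  have sB : {subset s' <= B}.
    move=> x xs'; have := vcycle_mem cs' xs'; rewrite in_setU1 => /predU1P[e|//].
    by rewrite -e xs' in zs'.
  have -> : cyclew w' s' = cyclew w s'.
    case: (s') sB => //= x p sB; apply: eq_pathw => a b ha hb.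
    by rewrite w'B //; apply: sB; [move: ha|move: hb];
      rewrite inE mem_rcons inE orbA orbb.
  apply: le_c; case/and4P: cs' => h1 h2 h3 _; apply/and4P; split=> //.
    apply: (sub_in_cycle (P := mem B)) h3; last exact/allP.
    by move=> a b Ba Bb; rewrite /posrel w'B.
  by apply/allP => x /sB /BV.
have [r q E] := rot_to zs'; rewrite -(cyclew_rot _ r).
move: cs'; rewrite -(vcycle_rot _ _ r) E => /and4P[].
case: q {E} => [|v t] // sz /andP[zq uq] pq Vq.
have qB : {subset v :: t <= B}.
  move=> x xq; have /allP/(_ x) := Vq; rewrite inE xq orbT => /(_ isT).
  by rewrite /= in_setU1 => /predU1P[e|//]; rewrite -e xq in zq.
have vB : v \in B by apply: qB; rewrite mem_head.
have uB : last v t \in B by apply: qB; rewrite mem_last.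
have pE : pathw w' v t = pathw w v t.
  by apply: eq_pathw => a b /qB Ba /qB Bb; apply: w'B.
move: pq; rewrite /= rcons_path /posrel w'C !w'z // => /and3P[zv pq uz].
rewrite pathw_rcons pE !w'z // addrA; apply: (detour_bound (V := V)) uz => //.
- apply: (sub_in_path (P := mem B)) pq; last exact/allP.
  by move=> a b Ba Bb; rewrite w'B.
- by case: (t) sz.
- by move=> x /qB /BV.
- by move=> x /qB /Bs.
Qed.

Lemma contract_admissible : admissible w' (z |: B) c.
Proof.
have [wC _ wge0] := ww; have w'w : is_weight w' := contractw_weight s z ww; have [w'C w'0 _] := w'w.
have us : uniq s by case/and4P: cs.
split=> [||x y].
- exact: le_trans (cyclew_ge0 _ ww) (le_c cs).
- exact: contract_cycle.
have star v : v \in B -> 0 < w' v z ->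
    connect (edge_del w' (z |: B) v z) v z \/ 2 * w' v z <= c.
  move=> Bv; rewrite w'z // => dv.
  have [a sa va] : exists2 a, a \in s & 0 < w v a.
    have [/hasP[a sa za]|/hasPn no] := boolP (has (fun a => 0 < w v a) s).
      by exists a.
    move: dv; rewrite big_seq big1 ?ltxx // => y0 /no; rewrite -leNgt => zy.
    by apply/eqP; rewrite eq_le zy wge0.
  (* With two neighbours on [s], the merged edge [vz] is light enough by [star_le], a second vertex
     of [B] being available. With a single neighbour [a], only [va] maps onto [vz], and the walk
     showing that [va] is no bridge descends. *)
  have [[b sb /andP[ba vb]]|[only _]] := sum_nbrs_other v ww us sa.
    right; have [v' Bv' vv'] := two_out Bv.
    apply: le_trans (le_c cs).
    exact: (star_le ww cs heavy (BV Bv) (BV Bv') (Bs Bv) (Bs Bv') vv' sb sa ba vb va).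
  left; have Ba : (a \in B) = false by rewrite BE sa.
  have fv : f v = v by rewrite /f Bv.
  have fa : f a = z by rewrite /f Ba.
  rewrite -[in X in connect _ X]fv -[X in connect _ _ X]fa.
  apply: (contract_connect (x := v) (y := a)); last first.
    by apply: bridgeless => //; [exact: BV | exact: vcycle_mem cs sa].
  have key b b' : b \in V -> b' \in V -> 0 < w b b' -> f b = v -> f b' = z ->
      [set b; b'] = [set v; a].
    move=> Vb Vb' bb'; rewrite /f; case: ifP => Bb; last first.
      by move=> e; rewrite -e (negbTE zB) in Bv.
    move=> bv; rewrite bv in bb' *; case: ifP => Bb'.
      by move=> e; rewrite e (negbTE zB) in Bb'.
    move=> _; congr [set _; _].
    have sb' : b' \in s by move: Bb'; rewrite BE Vb' andbT => /negbFE.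
    apply: only => //.
  move=> b b' Vb Vb' bb' ne E.
  have : f b \in [set v; z] by rewrite -E set21.
  have : f b' \in [set v; z] by rewrite -E set22.
  rewrite !inE => /orP[]/eqP e' /orP[]/eqP e; try by rewrite e e' eqxx in ne.
    by rewrite setUC; apply: key; rewrite // wC.
  exact: key.
rewrite !in_setU1 => /predU1P[->|Bx] /predU1P[->|By]; first by rewrite w'0 ltxx.
- rewrite w'C => /(star _ By) [h|]; last by right.
  left; rewrite (eq_connect (edge_delC _ _ _ _)).
  by rewrite (sym_connect_sym (edge_del_sym _ _ _ w'w)).
- exact: star.
rewrite w'B // => xy; left.
have fB k : k \in B -> f k = k by rewrite /f => ->.
rewrite -[X in connect _ X]fB // -[X in connect _ _ X]fB //.
apply: (contract_connect (x := x) (y := y)); last by apply: bridgeless => //; apply: BV.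
move=> a b Va Vb ab _ E.
have fxy k : f k \in [set x; y] -> f k = k.
  by rewrite /f; case: ifP => // _; rewrite !inE => /orP[]/eqP e; move: zB; rewrite e ?Bx ?By.
have fa : f a = a by apply: fxy; rewrite -E set21.
have fb : f b = b by apply: fxy; rewrite -E set22.
by rewrite -E fa fb.
Qed.

End Contraction.

(** * Induction on the number of vertices *)

(** Deleting the bridge separates the component [A] of [x] from the rest, and [xy] is the only edge
    between them. The two parts lose one [c] more than [V] does, and this pays for [2 * w x y]. *)
Lemma bridge_bound w V c x y : is_weight w -> admissible w V c ->
  (forall A, A \proper V -> A != set0 -> admissible w A c ->
     gweight w A <= (#|A|%:R - 1) * c) ->
  x \in V -> y \in V -> 0 < w x y -> ~~ connect (edge_del w V x y) x y ->
  gweight w V <= (#|V|%:R - 1) * c.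
Proof.
move=> ww adm IH Vx Vy xy ncon; have [wC w0 wge0] := ww.
pose A := [set a in V | connect (edge_del w V x y) x a].
have AV : A \subset V by apply/subsetP => a; rewrite inE => /andP[].
have Ax : x \in A by rewrite inE Vx connect0.
have Ay : y \notin A by rewrite inE Vy.
have cross k l : k \in A -> l \in V -> l \notin A -> 0 < w k l -> k = x /\ l = y.
  rewrite !inE => /andP[Vk xk] Vl; rewrite Vl /= => xl kl.
  have [E|ne] := eqVneq [set k; l] [set x; y]; last first.
    case/negP: xl; apply: connect_trans xk (connect1 _).
    by rewrite /edge_del /= Vk Vl kl.
  have : k \in [set x; y] by rewrite -E set21.
  have : l \in [set x; y] by rewrite -E set22.
  rewrite !inE => /orP[]/eqP el /orP[]/eqP ek //.
  - by rewrite el ek w0 ltxx in kl.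
  - by rewrite el connect0 in xl.
  - by rewrite ek (negbTE ncon) in xk.
have By : y \in V :\: A by rewrite inE Ay.
have bA : gweight w A <= (#|A|%:R - 1) * c.
  apply: IH; last 1 first.
  - apply: (admissible_part adm AV Ax) => k l Ak Vl Al; last rewrite wC;
      by move=> /(cross _ _ Ak Vl Al)[].
  - by apply/properP; split=> //; exists y.
  - by apply/set0Pn; exists x.
have bB : gweight w (V :\: A) <= (#|V :\: A|%:R - 1) * c.
  apply: IH; last 1 first.
  - apply: (admissible_part adm (subsetDl _ _) By) => k l; rewrite !inE;
    move=> /andP[Ak Vk] Vl; rewrite Vl andbT negbK => Al; first rewrite wC;
    by move=> /(cross l k _ Vk)[]; rewrite ?inE ?Vl.
  - by apply/properP; split; [exact: subsetDl | exists x; rewrite // inE Ax].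
  - by apply/set0Pn; exists y.
have cut : \sum_(a in A) \sum_(b in V :\: A) w a b = w x y.
  rewrite (bigD1 x) //= [X in _ + X]big1 ?addr0; last first.
    move=> a /andP[Aa ax]; rewrite big1 // => b; rewrite inE => /andP[Ab Vb].
    have [ab|ab] := ltP 0 (w a b); last by apply/eqP; rewrite eq_le ab wge0.
    by have [e _] := cross a b Aa Vb Ab ab; rewrite e eqxx in ax.
  rewrite (bigD1 y) //= [X in _ + X]big1 ?addr0 // => b /andP[].
  rewrite inE => /andP[Ab Vb] yb.
  have [ab|ab] := ltP 0 (w x b); last by apply/eqP; rewrite eq_le ab wge0.
  by have [_ e] := cross x b Ax Vb Ab ab; rewrite e eqxx in yb.
have card : (#|V|%:R : R) = #|A|%:R + #|V :\: A|%:R.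
  by rewrite -natrD -(cardsID A V) (setIidPr AV).
have [_ _ /(_ x y Vx Vy xy)[con|le2]] := adm; first by rewrite con in ncon.
by rewrite (gweight_split ww AV) cut card; lra.
Qed.

Lemma nonspanning_bound w V c s y0 : is_weight w ->
  (forall w' A c', is_weight w' -> (#|A| < #|V|)%N -> admissible w' A c' -> A != set0 ->
     gweight w' A <= (#|A|%:R - 1) * c') ->
  (forall s', vcycle w V s' -> cyclew w s' <= c) ->
  (forall x y, x \in V -> y \in V -> 0 < w x y -> connect (edge_del w V x y) x y) ->
  vcycle w V s -> y0 \in V -> y0 \notin s -> heaviest_nonspanning w V s ->
  gweight w V <= (#|V|%:R - 1) * c.
Proof.
move=> ww IH le_c bridgeless cs Vy0 ys0 heavy; have [wC w0 wge0] := ww.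
have us : uniq s by case/and4P: cs.
have sz : (2 < size s)%N by case/and4P: cs.
pose A := [set x in s]; pose B := V :\: A.
have cardA : #|A| = size s by rewrite cardsE; apply/card_uniqP.
have AV : A \subset V by apply/subsetP => x; rewrite inE; apply: vcycle_mem cs.
have cardV : (#|A| + #|B| = #|V|)%N by rewrite -(cardsID A V) (setIidPr AV).
have By0 : y0 \in B by rewrite !inE ys0.
have B0 : (0 < #|B|)%N by apply/card_gt0P; exists y0.
have cs_c := le_c _ cs; have cs0 := cyclew_ge0 s ww.
have sumA x : \sum_(a in A) w x a = \sum_(a <- s) w x a.
  by rewrite big_uniq //=; apply: eq_bigl => a; rewrite inE.
(* On the vertices of [s] the constant improves from [c] to the weight of [s], since every cycle
   there misses [y0]; no edge there is a bridge, as its ends lie on [s]. *)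
have bA : gweight w A <= (#|A|%:R - 1) * cyclew w s.
  apply: IH => //; first by rewrite -cardV -[ltnLHS]addn0 ltn_add2l.
    split=> // [s' cs'|x y].
      apply: heavy (vcycle_subset cs' _) Vy0 _ => [x /(vcycle_mem cs')|].
        exact: (subsetP AV).
      by apply: contra ys0 => h; have := vcycle_mem cs' h; rewrite in_set.
    rewrite !inE => xs ys xy; left; apply: (cycle_edge_del ww _ xs ys).
      by apply: (vcycle_subset cs) => a; rewrite inE.
    by apply: contraTneq xy => ->; rewrite w0 ltxx.
  by rewrite -card_gt0 cardA (ltn_trans _ sz).
have E : gweight w V = gweight w A + gweight w B
    + 2 * \sum_(x in B) \sum_(a <- s) w x a.
  rewrite (gweight_split ww AV) -/B; congr (_ + 2 * _).
  rewrite exchange_big /=; apply: eq_bigr => x _; rewrite -sumA.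
  by apply: eq_bigr => a _; rewrite wC.
have cardVR : (#|V|%:R : R) = #|A|%:R + #|B|%:R by rewrite -natrD cardV.
have [B1|B1] := leqP #|B| 1.
  have {}B1 : #|B| = 1%N by apply/eqP; rewrite eqn_leq B1.
  have /cards1P[v Bv] : #|B| == 1%N by rewrite B1.
  have [Vv vs] : v \in V /\ v \notin s.
    have : v \in B by rewrite Bv set11.
    by rewrite !inE => /andP[].
  have gB : gweight w B = 0 by rewrite Bv /gweight !big_set1 w0.
  have dv : 2 * (\sum_(a <- s) w v a) <= cyclew w s + (size s)%:R * (c - cyclew w s).
    have k0 : 0 <= (size s)%:R * (c - cyclew w s) by rewrite mulr_ge0 ?ler0n ?subr_ge0.
    have [/hasP[a sa va]|/hasPn no] := boolP (has (fun a => 0 < w v a) s); last first.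
      rewrite big_seq big1 ?mulr0 ?addr_ge0 // => a /no; rewrite -leNgt => va.
      by apply/eqP; rewrite eq_le va wge0.
    have [[b sb /andP[ba vb]]|[only _]] := sum_nbrs_other v ww us sa.
      exact: (star_bound ww cs Vv vs (fun s' h _ => le_c s' h) sb sa ba vb va).
    (* A single neighbour [a] is impossible: a walk from [v] to [a] avoiding [va] starts with an
       edge to another vertex of [s]. *)
    have /connectP[[|b p] /=] := bridgeless v a Vv (vcycle_mem cs sa) va.
      by move=> _ e; rewrite -e sa in vs.
    move=> /andP[/and4P[_ Vb vb ne] _] _.
    have : b \in s.
      apply: contraTT vb => sb; have : b \in B by rewrite !inE sb.
      by rewrite Bv inE => /eqP->; rewrite w0 ltxx.
    by move=> sb; rewrite (only b sb vb) eqxx in ne.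
  have nE : (size s)%:R = #|V|%:R - 1 :> R by rewrite cardVR B1 cardA addrK.
  move: bA dv; rewrite E gB Bv big_set1 cardA nE.
  move: (#|V|%:R : R) => n; lra.
have [z zs] : exists z, z \in s by case: (s) sz => // z ? _; exists z; rewrite mem_head.
have zB : z \notin B by rewrite !inE zs.
have two x : x \in B -> exists2 y, y \in B & x != y.
  move=> Bx; have /card_gt1P[a [b [Ba Bb ab]]] := B1.
  by have [e|ne] := eqVneq x a; [exists b; rewrite ?e | exists a].
have adm := contract_admissible ww cs le_c bridgeless heavy zs two.
have cardzB : #|z |: B| = #|B|.+1 by rewrite cardsU1 zB.
(* The contracted graph has [#|B| + 1] vertices, fewer than [V] because [s] has at least three. Its
   weight accounts for all edges not inside [s]. *)
have := IH _ _ _ (contractw_weight s z ww) _ adm.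
rewrite cardzB => /(_ _ _) h.
have {h} : gweight (contractw w s z) (z |: B) <= (#|B|.+1%:R - 1) * c.
  apply: h; first by rewrite -cardV -[leqLHS]add2n leq_add2r cardA ltnW.
  by apply/set0Pn; exists z; rewrite setU11.
rewrite gweight_contract // -[#|B|.+1]addn1 natrD addrK E cardVR => h.
have : (#|A|%:R - 1) * cyclew w s <= (#|A|%:R - 1) * c.
  by apply: ler_wpM2l; rewrite // subr_ge0 ler1n cardA (ltn_trans _ sz).
move: bA h; move: (#|A|%:R : R) (#|B|%:R : R) => k l; lra.
Qed.

(** The induction generalises over [w] and [c] too: contraction changes the weights, and restriction
    to a cycle lowers the constant. *)
Theorem gweight_bound w V c : is_weight w -> admissible w V c -> V != set0 ->
  gweight w V <= (#|V|%:R - 1) * c.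
Proof.
have [m] := ubnP #|V|; elim: m w V c => // m IH w V c Vm ww adm V0.
have [c0 le_c bri] := adm; have [wC w0 wge0] := ww.
have card1 : 0 <= (#|V|%:R - 1 : R) by rewrite subr_ge0 ler1n card_gt0.
have [/existsP[x /existsP[y /and4P[Vx Vy xy ncon]]]|/existsPn nobridge] := boolP
  [exists x, exists y, [&& x \in V, y \in V, 0 < w x y & ~~ connect (edge_del w V x y) x y]].
  apply: (bridge_bound ww adm) ncon => // A AV A0 admA.
  by apply: IH => //; apply: leq_trans (proper_card AV) Vm.
have bridgeless x y : x \in V -> y \in V -> 0 < w x y ->
    connect (edge_del w V x y) x y.
  move=> Vx Vy xy; have /existsPn/(_ y) := nobridge x.
  by rewrite Vx Vy xy negbK.
have [/existsP[x /existsP[y /and3P[Vx Vy xy]]]|/existsPn noedge] := boolP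
  [exists x, exists y, [&& x \in V, y \in V & 0 < w x y]]; last first.
  rewrite /gweight big1 ?mulr_ge0 // => x Vx; rewrite big1 // => y Vy.
  have /existsPn/(_ y) := noedge x.
  by rewrite Vx Vy /= -leNgt => xy; apply/eqP; rewrite eq_le xy wge0.
have [s cs] := exists_vcycle ww Vx xy (bridgeless x y Vx Vy xy).
have [[s' [y' [cs' Vy' ys']]]|all_span] :=
  pselect (exists s' y', [/\ vcycle w V s', y' \in V & y' \notin s']).
  have [s0 [y0 [cs0 Vy0 ys0 heavy]]] := exists_heaviest_nonspanning cs' Vy' ys'.
  apply: (nonspanning_bound ww _ le_c bridgeless cs0 Vy0 ys0 heavy).
  by move=> w' A c' ww' AV admA A0; apply: IH => //; apply: leq_trans AV Vm.
have span s' : vcycle w V s' -> {subset V <= s'}.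
  move=> cs' y' Vy'; apply/negPn/negP => ys'; apply: all_span.
  by exists s', y'.
apply: le_trans (spanning_cycle_weight ww cs span) _.
(* A cycle provides at least three vertices, so the bound [2 * c] for a graph with only spanning
   cycles suffices. *)
have : 2 * c <= (#|V|%:R - 1) * c.
  apply: ler_wpM2r => //.
  have /and4P[sz us _ /allP Vs] := cs.
  have : (3 <= #|V|)%N.
    rewrite (leq_trans sz) // -(card_uniqP us); apply/subset_leq_card/subsetP => a.
    exact: Vs.
  by rewrite -(ler_nat R); move: (#|V|%:R : R) => k; lra.
by have := le_c s cs; lra.
Qed.

End WeightedGraph.

(** * The weights [w E / Cw E] *)

Section CycleEdges.
Variables (R : realFieldType) (T : finType) (g : rel T) (w : {set T} -> R).
Hypotheses (g_sym : symmetric g) (g_irr : irreflexive g).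
Hypothesis w_pos : forall E, is_edge g E -> 0 < w E.

Lemma is_edgeP x y : g x y -> is_edge g [set x; y].
Proof. by move=> xy; apply/existsP; exists x; apply/existsP; exists y; rewrite xy eqxx. Qed.

Lemma next_next_neq (s : seq T) x : (2 < size s)%N -> uniq s -> x \in s ->
  next s (next s x) != x.
Proof.
move=> sz us xs; have [r q E] := rot_to xs; rewrite -!(next_rot r us) E.
move: us sz; rewrite -(rot_uniq r) -(size_rot r) E.
case: q {E} => [|y [|z q]] //=; rewrite !inE !negb_or.
move=> /andP[/and3P[xy xz _] _] _.
by rewrite eqxx [y == x]eq_sym (negbTE xy) eqxx eq_sym.
Qed.

(** Two positions could share an edge only by being each other's successor, which happens on no
    cycle of length at least three. Sums over edges thus become sums over vertices. *)
Lemma cycle_edge_inj (s : seq T) : (2 < size s)%N -> uniq s ->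
  {in s &, injective (fun x => [set x; next s x])}.
Proof.
move=> sz us x y xs ys E.
have : x \in [set y; next s y] by rewrite -E set21.
have : y \in [set x; next s x] by rewrite E set21.
rewrite !inE => /orP[/eqP->//|/eqP yx] /orP[/eqP//|/eqP xy].
by have := next_next_neq sz us xs; rewrite -yx -xy eqxx.
Qed.

Lemma wsum_cycle (s : seq T) : (2 < size s)%N -> uniq s ->
  wsum w [set [set x; next s x] | x in s] = \sum_(x <- s) w [set x; next s x].
Proof.
by move=> sz us; rewrite /wsum big_imset ?big_uniq //=; apply: cycle_edge_inj.
Qed.

Lemma wsum_cycle_gt0 F E : is_cycle_edges g F -> E \in F -> 0 < wsum w F.
Proof.
move=> [s [sz us cs ->]] EF.
have pos D : D \in [set [set x; next s x] | x in s] -> 0 < w D.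
  by case/imsetP => x xs ->; apply/w_pos/is_edgeP/(next_cycle cs xs).
rewrite /wsum (bigD1 E) //=; apply: ltr_pwDl; first exact: pos.
by apply: sumr_ge0 => D /andP[/pos/ltW].
Qed.

Lemma wsum_le_Cw F E : is_cycle_edges g F -> E \in F -> wsum w F <= Cw g w E.
Proof.
move=> cF EF; rewrite /Cw ifT; last by apply/asboolP; exists F.
by apply: le_bigmax_cond; rewrite EF andbT; apply/asboolP.
Qed.

Lemma Cw_gt0 E : is_edge g E -> 0 < Cw g w E.
Proof.
move=> eE; have [[F [cF EF]]|no] := pselect (exists F, is_cycle_edges g F /\ E \in F).
  exact: lt_le_trans (wsum_cycle_gt0 cF EF) (wsum_le_Cw cF EF).
by rewrite /Cw ifF ?mulr_gt0 ?ltr0n ?w_pos //; apply/asboolP.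
Qed.

(** The value is set to zero off the edges, where the sign of [w] is unknown, so that the pairs of
    positive weight are exactly those of [g]. *)
Definition relw (x y : T) : R :=
  if g x y then w [set x; y] / Cw g w [set x; y] else 0.

Lemma relw_gt0 x y : (0 < relw x y) = g x y.
Proof.
rewrite /relw; case: ifP => xy; last by rewrite ltxx.
by rewrite divr_gt0 ?w_pos ?Cw_gt0 //; apply: is_edgeP.
Qed.

Lemma relw_weight : is_weight relw.
Proof.
split=> [x y|x|x y]; rewrite /relw.
- by rewrite g_sym setUC.
- by rewrite g_irr.
- by case: ifP => // xy; rewrite divr_ge0 // ltW ?w_pos ?Cw_gt0 //; apply: is_edgeP.
Qed.

Lemma relw_vcycle s :
  vcycle relw setT s = [&& (2 < size s)%N, uniq s & path.cycle g s].
Proof.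
rewrite /vcycle (@eq_cycle _ _ g) => [|x y]; last exact: relw_gt0.
have -> : all (mem [set: T]) s by apply/allP => x _; apply: in_setT.
by rewrite andbT.
Qed.

(** Every edge of a cycle [F] has [Cw] at least [wsum w F], so the ratios along [F] add up to at
    most one. An edge on no cycle has ratio exactly one half. *)
Lemma relw_admissible : admissible relw setT 1.
Proof.
split=> // [s|x y _ _].
  rewrite relw_vcycle => /and3P[sz us cs]; rewrite cyclew_next //.
  set F := [set [set x; next s x] | x in s].
  have cF : is_cycle_edges g F by exists s.
  have inF x : x \in s -> [set x; next s x] \in F by move=> xs; apply: imset_f.
  have gF x : x \in s -> g x (next s x) by apply: next_cycle.
  have [x0 xs0] : exists x, x \in s by case: (s) sz => // x ? _; exists x; rewrite mem_head.
  have F0 := wsum_cycle_gt0 cF (inF _ xs0).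
  apply: (@le_trans _ _ (\sum_(x <- s) w [set x; next s x] / wsum w F)).
    rewrite !big_seq; apply: ler_sum => x xs; rewrite /relw gF //.
    have eE := is_edgeP (gF x xs).
    by rewrite ler_wpM2l ?(ltW (w_pos eE)) // lef_pV2 ?posrE ?Cw_gt0 // wsum_le_Cw ?inF.
  by rewrite -mulr_suml -wsum_cycle // divff // gt_eqF.
rewrite relw_gt0 => xy; have eE := is_edgeP xy.
have [[F [cF EF]]|no] := pselect (exists F, is_cycle_edges g F /\ [set x; y] \in F).
  left; case: cF EF => s [sz us cs ->] /imsetP[k ks E].
  have sub a : a \in [set x; y] -> a \in s.
    by rewrite E !inE => /orP[]/eqP->; rewrite ?mem_next.
  apply: (cycle_edge_del (s := s) relw_weight); rewrite ?sub ?set21 ?set22 //.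
    by rewrite relw_vcycle sz us.
  by apply: contraTneq xy => ->; rewrite g_irr.
right; rewrite /relw xy /Cw ifF; last exact/asboolP.
have w0 : w [set x; y] != 0 by rewrite gt_eqF ?w_pos.
by have -> : 2 * (w [set x; y] / (2 * w [set x; y])) = 1 by field.
Qed.

Lemma gweight_relw :
  gweight relw setT = 2 * \sum_(E : {set T} | is_edge g E) w E / Cw g w E.
Proof.
rewrite /gweight pair_big /=.
under eq_bigl do rewrite !in_setT.
(* Ordered pairs are grouped by the edge they span; each edge has exactly two orientations, distinct
   because [g] has no loops. *)
rewrite -big_mkcond /= (partition_big (fun p : T * T => [set p.1; p.2]) (is_edge g)) /=; last first.
  by move=> p /is_edgeP.
rewrite mulr_sumr; apply: eq_bigr => E /existsP[x /existsP[y /andP[xy /eqP EE]]].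
under eq_bigr => p /andP[_ /eqP->] do [].
have xNy : x != y by apply: contraTneq xy => ->; rewrite g_irr.
rewrite sumr_const mulr_natl; congr (_ *+ _).
have -> : 2%N = #|[set (x, y); (y, x)]| by rewrite cards2 xpair_eqE (negbTE xNy).
apply: eq_card => -[a b]; rewrite !inE /= unfold_in /= !xpair_eqE EE.
apply/andP/orP => [[ab /eqP E2]|[/andP[/eqP-> /eqP->]|/andP[/eqP-> /eqP->]]].
- have : a \in [set x; y] by rewrite -E2 set21.
  have : b \in [set x; y] by rewrite -E2 set22.
  rewrite !inE => /orP[]/eqP eb /orP[]/eqP ea; rewrite ea eb ?eqxx.
  + by rewrite ea eb g_irr in ab.
  + by right.
  + by left.
  + by rewrite ea eb g_irr in ab.
- by [].
- by rewrite g_sym xy setUC.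
Qed.

End CycleEdges.

Theorem theorem2p1 (R : realFieldType) (T : finType) (g : rel T)
  (g_sym : symmetric g) (g_irr : irreflexive g)
  (T_nonempty : (0 < #|T|)%N)
  (g_conn : forall x y : T, connect g x y)
  (w : {set T} -> R) (w_pos : forall E, is_edge g E -> 0 < w E) :
  \sum_(E : {set T} | is_edge g E) w E / Cw g w E <= (#|T|%:R - 1) / 2.
Proof.
have T0 : [set: T] != set0 by rewrite -card_gt0 cardsT.
have := gweight_bound (relw_weight g_sym g_irr w_pos) (relw_admissible g_sym g_irr w_pos) T0.
by rewrite gweight_relw // cardsT mulr1; move: (#|T|%:R : R) => n; lra.
Qed.
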